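(* Let $A$ be the smallest set of positive integers such that $2,3\in A$ and such that $ab-1\in A$ whenever $a,b\in A$ and $a\neq b$. Then there is a constant $c>0$ such that \[ |A\cap[1,x]|\geq cx \] for all sufficiently large real $x$.
   Context: ''Smallest'' means with respect to inclusion: $A$ is the intersection of all sets $S$ of positive integers with $2,3\in S$ and $ab-1\in S$ for all distinct $a,b\in S$. $|\cdot|$ denotes cardinality. *)

(* Defs.v *)
From mathcomp Require Import all_boot all_order all_algebra finmap.
From mathcomp Require Import all_classical all_reals all_analysis.
Set Implicit Arguments.
Unset Strict Implicit.
Unset Printing Implicit Defensive.

Local Open Scope classical_set_scope.
Local Open Scope nat_scope.

(* The subtraction is truncated, but harmless: for positive a and b, a * b is
   at least 1. *)
Definition mul_pred_closed (S : set nat) : Prop :=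
  S `<=` [set n | 0 < n] /\
  forall a b, S a -> S b -> a <> b -> S (a * b - 1).

(* [smallest C G] is the intersection of all sets M with C M and G `<=` M. *)
Definition setA23 : set nat := smallest mul_pred_closed [set 2; 3].

Local Open Scope ring_scope.

(* [fset_set] is the set itself viewed as a finite set when it is finite, as is
   the case here, and is empty otherwise. *)
Definition count_upto (R : realType) (B : set nat) (x : R) : nat :=
  #|` fset_set (B `&` [set n | 1 <= (n%:R : R) <= x])|.

(* Main.v *)
Require Import Defs.
From mathcomp Require Import all_boot all_order all_algebra finmap.
From mathcomp Require Import all_classical all_reals all_analysis.
From mathcomp Require Import zify ssrZ ring lra.

(** Put C = A - 1. Since a (c + 1) - 1 = (a c + (a - 2)) + 1, the set C is
    closed under c |-> a c + (a - 2) for every a in A other than c + 1. Only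
    the five letters a = 2, 3, 5, 9, 14 of A are used. A word w in these
    letters acts on C by an affine map of slope prod w, so the point is to show
    that the images of one starting point 16 (that is, 17 in A) under words of
    one and the same slope M fill a positive proportion of [16M, 17M).

    Covering. Given a real target at distance d above an element c of C, the
    letter a leads to a target at distance a d - (a - 2) above a c + (a - 2).
    If 0 <= d <= 11/12, some letter keeps the new distance in [0, 11/12],
    because the intervals on which the five letters do so cover [0, 11/12].
    Hence the greedy expansion of a target never gets stuck. This is made
    discrete with distances in units of 1/36 ([policy], [good], [good_child]);
    a cell of width 1/36 is cut by the letter a into a cells of the next
    level, all of them again close above an element of C.

    One slope for many targets. The letter depends on the target, so different
    targets could end with many different slopes, and the number of possible
    slopes grows like a power of the length of the words. The letter is not
    forced everywhere, though: the intervals overlap. Five ways to break ties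
    give five policies, and there are five integer functionals of the word, the
    [imbalance]s, of sum zero, such that under policy k every imbalance other
    than the k-th drifts downwards ([drifts_down_110], a finite computation).
    At regular times one switches to a policy k for which the k-th imbalance is
    nonpositive at that moment. The exponential potential
    sum_i exp (eta * imbalance i) then stays bounded in mean
    ([blocks_potential]), so that for at least half of the targets all the
    imbalances are below a constant L ([steered]). As they sum to zero they
    take boundedly many values, and together with the length they determine the
    word up to order, hence its slope. By the pigeonhole principle one slope
    carries a fixed proportion of the targets ([many_elements]).

    All scales. The slopes found for words of lengths s q, s = 0, 1, 2, ...,
    tend to infinity, and consecutive ones have a bounded ratio because the
    words are balanced ([letter_prod_ratio]). So every large x is within a
    constant factor of 17 M for one of these slopes M, and [1, x] contains the
    elements of A found between 16 M and 17 M. *)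
Set Implicit Arguments.
Unset Strict Implicit.
Unset Printing Implicit Defensive.

Local Open Scope classical_set_scope.
Local Open Scope ring_scope.
Import Order.TTheory GRing.Theory Num.Theory.

(** * The letters and the covering of an interval *)

Lemma setA23_closed a b : setA23 a -> setA23 b -> a <> b -> setA23 (a * b - 1)%N.
Proof.
move=> Aa Ab ab M [[Mpos Mcl] M23].
by apply: (Mcl _ _ _ _ ab); [apply: Aa | apply: Ab].
Qed.

Lemma setA23_2 : setA23 2%N.
Proof. by move=> M [_]; apply; left. Qed.

Lemma setA23_3 : setA23 3%N.
Proof. by move=> M [_]; apply; right. Qed.

Definition letters : seq nat := [:: 2; 3; 5; 9; 14]%N.

Lemma setA23_17 : setA23 17%N.
Proof.
have A5 : setA23 5 := @setA23_closed 2 3 setA23_2 setA23_3 ltac:(by []).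
have A9 : setA23 9 := @setA23_closed 2 5 setA23_2 A5 ltac:(by []).
exact: (@setA23_closed 2 9 setA23_2 A9 ltac:(by [])).
Qed.

Lemma setA23_letters a : a \in letters -> setA23 a.
Proof.
have A5 : setA23 5 := @setA23_closed 2 3 setA23_2 setA23_3 ltac:(by []).
have A9 : setA23 9 := @setA23_closed 2 5 setA23_2 A5 ltac:(by []).
have A14 : setA23 14 := @setA23_closed 3 5 setA23_3 A5 ltac:(by []).
rewrite !inE => /or4P[/eqP->|/eqP->|/eqP->|/orP[]/eqP->] //.
- exact: setA23_2.
- exact: setA23_3.
Qed.

(** Row k lists the letters that policy k takes at the offsets 12, 13, 14, 15
    (where both 2 and 3 are possible) and at the offset 22 (where both 3 and 5
    are). *)
Definition free_choices : seq (seq nat) :=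
  [:: [:: 2; 2; 2; 2; 3]; [:: 2; 2; 3; 3; 3]; [:: 2; 3; 2; 3; 5];
      [:: 3; 2; 3; 2; 5]; [:: 3; 3; 3; 3; 3]]%N.

(** The letter that policy k takes at the distance j / 36. The letter a is
    possible at j when all its children [next a j i], i < a, are between 0 and
    32, which means that the cell of distances [j/36, (j+1)/36] is mapped into
    [0, 33/36] by d |-> a d - (a - 2). *)
Definition policy (k j : nat) : nat :=
  let free := nth [::] free_choices k in
  (if j < 12 then 2 else if j < 16 then nth 2 free (j - 12)
   else if j < 22 then 3 else if j < 23 then nth 3 free 4
   else if j < 28 then 5 else if j < 31 then 9 else 14)%N.

(** The offsets of the a cells into which the letter a cuts the cell at offset
    j. The subtraction is truncated, but [policy_valid] shows that it is exact
    for the letters in use. *)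
Definition next (a j i : nat) : nat := (a * j + i - 36 * (a - 2))%N.

Lemma policy_valid k j : (k < 5)%N -> (j < 33)%N ->
  [&& policy k j \in letters, (36 * (policy k j - 2) <= policy k j * j)%N
    & (policy k j * j + policy k j <= 33 + 36 * (policy k j - 2))%N].
Proof.
move=> k5 j33.
have /allP/(_ k)/(_ _)/allP/(_ j) : all (fun k => all (fun j =>
    [&& policy k j \in letters, (36 * (policy k j - 2) <= policy k j * j)%N
      & (policy k j * j + policy k j <= 33 + 36 * (policy k j - 2))%N])
    (iota 0 33)) (iota 0 5) by vm_compute.
by rewrite !mem_iota; apply.
Qed.

Lemma letters_ge2 a : a \in letters -> (2 <= a <= 14)%N.
Proof. by rewrite !inE => /or4P[/eqP->|/eqP->|/eqP->|/orP[]/eqP->]. Qed.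

Lemma next_lt (k j i : nat) : (k < 5)%N -> (j < 33)%N -> (i < policy k j)%N ->
  (next (policy k j) j i < 33)%N.
Proof. by move=> k5 j33; case/and3P: (policy_valid k5 j33); rewrite /next; lia. Qed.

(** P = 36 n + j stands for the cell of targets from 16 m + n + j/36 to
    16 m + n + (j+1)/36; it is good when 16 m + n is in C and j/36 is an
    admissible distance, so that the cell can be expanded further. *)
Definition good (m P : nat) : Prop := (P %% 36 < 33)%N /\ setA23 (16 * m + P %/ 36 + 1)%N.

(** The element of A behind the children is the product of the letter and of
    the element 16 m + n + 1 behind P, minus 1. The constant 16 keeps that
    element above every letter, so the two factors are distinct. *)
Lemma good_child m P k i : (k < 5)%N -> good m P ->
  (i < policy k (P %% 36))%N -> (0 < m)%N ->
  good (policy k (P %% 36) * m) (policy k (P %% 36) * P + i) /\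
  ((policy k (P %% 36) * P + i) %% 36 = next (policy k (P %% 36)) (P %% 36) i)%N.
Proof.
set j := (P %% 36)%N; set a := policy k j => k5 [j33 AP] ia m0.
have /and3P[aL lo hi] := policy_valid k5 j33; rewrite -/a in aL lo hi.
have /andP[a2 a14] := letters_ge2 aL.
have j'33 := next_lt k5 j33 ia; rewrite -/a in j'33.
have E : (a * P + i = (a * (P %/ 36) + (a - 2)) * 36 + next a j i)%N.
  by rewrite {1}(divn_eq P 36) -/j /next; nia.
have j'36 : (next a j i < 36)%N by lia.
split; last by rewrite E modnMDl modn_small.
split; first by rewrite E modnMDl modn_small.
rewrite E divnMDl // (divn_small j'36) addn0.
have -> : (16 * (a * m) + (a * (P %/ 36) + (a - 2)) + 1 =
          a * (16 * m + P %/ 36 + 1) - 1)%N by nia.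
apply: setA23_closed => //; first exact: setA23_letters.
by move=> H; move: a14 m0; rewrite H; lia.
Qed.

(** * Counting targets *)

(** Rescaling by m / M sends the cell p of level M into the cell P of level m
    when the quotient below is P. Here M is the final slope, fixed in advance: good
    cells of level M are counted whether or not they are reached by an
    expansion through P. *)
Definition hits (M m P : nat) : nat :=
  (\sum_(p < 36 * M) (`[< good M p >] && (p * m %/ M == P)))%N.

(** A partition of the cell P into a equal parts. It holds for every a, whether
    or not P is good, so the letter may be chosen freely at each cell. *)
Lemma hits_split (M m P a : nat) : (0 < a)%N ->
  hits M m P = (\sum_(i < a) hits M (a * m) (a * P + i))%N.
Proof.
move=> a0; rewrite exchange_big /=; apply: eq_bigr => p _.
have -> : (p * m %/ M = p * (a * m) %/ M %/ a)%N.
  by rewrite -divnMA mulnCA (mulnC M) divnMl.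
set q := (_ %/ M)%N; case: (asboolP (good M p)) => _ /=; last first.
  by rewrite big1.
have qa : (q %% a < a)%N by rewrite ltn_mod.
case: eqP => [qP|qP].
  rewrite (bigD1 (Ordinal qa)) //= -qP mulnC -divn_eq eqxx big1 ?addn0 // => i.
  by rewrite -val_eqE /= => /eqP iq; apply/eqP; rewrite eqb0; apply/eqP; lia.
rewrite big1 // => i _; apply/eqP; rewrite eqb0; apply/eqP => qi; apply: qP.
by rewrite qi mulnC divnMDl // divn_small ?addn0.
Qed.

Lemma hits_self (M P : nat) : good M P -> (P < 36 * M)%N -> (0 < hits M M P)%N.
Proof.
move=> gP lP; have M0 : (0 < M)%N by lia.
by rewrite /hits (bigD1 (Ordinal lP)) //= (asboolT gP) mulnK // eqxx.
Qed.

Lemma sum_div36 (F : nat -> nat) (M : nat) :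
  (\sum_(p < 36 * M) F (p %/ 36) = 36 * \sum_(q < M) F q)%N.
Proof.
elim: M => [|M IH]; first by rewrite !big_ord0.
rewrite mulnS addnC -!(big_mkord xpredT (fun p => F (p %/ 36)%N)).
rewrite -!(big_mkord xpredT F) in IH *.
rewrite (@big_cat_nat _ _ _ (36 * M)) ?leq_addr //=.
rewrite (big_mkord _ (fun p => F (p %/ 36)%N)) IH big_nat_recr //= mulnDr; congr addn.
rewrite -{1}[(36 * M)%N]add0n big_addn addKn (eq_big_nat _ _ (F2 := fun=> F M)).
  by rewrite sum_nat_const_nat.
by move=> p p36; rewrite mulnC addnC divnMDl // divn_small ?addn0.
Qed.

Definition window_count (M : nat) : nat := \sum_(q < M) `[< setA23 (16 * M + q + 1)%N >].

(** Good cells of level M with the same quotient by 36 lie above the same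
    element of A, and there are at most 36 of them. *)
Lemma hits_le (M : nat) : (0 < M)%N ->
  (hits M 1 0 <= 36 * window_count M)%N.
Proof.
move=> M0; rewrite -(sum_div36 (fun q => nat_of_bool `[< setA23 (16 * M + q + 1)%N >])).
apply: leq_sum => p _; case: (asboolP (good M p)) => //= -[_ Ap].
by rewrite (asboolT Ap) leq_b1.
Qed.

(** * Words, imbalances and policies *)

(** One row for each imbalance, one column for each letter. The five policies
    have stationary letter frequencies that are the vertices of a simplex in
    the space of frequency vectors; row i is, rounded to integers, a linear
    form that is negative at every vertex but the i-th. The columns sum to
    zero. *)
Definition weight_table : seq (seq int) :=
  [:: [::  -1;  -4; -11;  41;  22]; [:: -11;   5;  25; -33;  10];
      [::  -2;   3;  -1;  37; -94]; [::  12; -13;  12; -52;  43];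
      [::   2;   9; -25;   7;  19]]%Z.

Definition weight (i a : nat) : int := nth 0 (nth [::] weight_table i) (index a letters).

Definition imbalance (i : nat) (w : seq nat) : int := foldr (fun a => +%R (weight i a)) 0 w.

Definition letter_prod (w : seq nat) : nat := foldr muln 1%N w.

(** A policy whose own imbalance is nonpositive. One exists because the
    imbalances sum to zero; it is the policy under which the only imbalance
    that may grow is one that has room to. *)
Definition mode (w : seq nat) : nat := find (fun i => imbalance i w <= 0) (iota 0 5).

Lemma imbalance_sum w : all (mem letters) w ->
  imbalance 0 w + imbalance 1 w + imbalance 2 w + imbalance 3 w + imbalance 4 w = 0.
Proof.
elim: w => [//|a w IH] /= /andP[aL /IH]; set x := imbalance 0 w; set y := imbalance 1 w.
set z := imbalance 2 w; set t := imbalance 3 w; set u := imbalance 4 w => E.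
have : weight 0 a + weight 1 a + weight 2 a + weight 3 a + weight 4 a = 0.
  by move: aL; rewrite !inE => /or4P[/eqP->|/eqP->|/eqP->|/orP[]/eqP->].
by lia.
Qed.

Lemma size_lt_letter_prod w : all (mem letters) w -> (size w < letter_prod w)%N.
Proof.
elim: w => [//|a w IH] /andP[/letters_ge2 /andP[a2 _] /IH].
by rewrite /=; nia.
Qed.

Section Operators.
Context {R : realType} (q : nat).
Implicit Types (f g : seq nat -> nat -> R).

(** The mean of f after r random letters, when policy k picks the letters and
    the a children of a cell are equally likely. Words grow at the front. *)
Fixpoint run (k r : nat) f (w : seq nat) (j : nat) : R :=
  if r is r'.+1 then
    let a := policy k j in
    (\sum_(i < a) run k r' f (a :: w) (next a j i)) / a%:R
  else f w j.

(** A policy is kept for a whole block because its effect on the imbalances has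
    a definite sign only in the mean over many letters. *)
Fixpoint blocks (s : nat) f (w : seq nat) (j : nat) : R :=
  if s is s'.+1 then run (mode w) q (blocks s' f) w j else f w j.

(** A cell of level m holds about M / m cells of level M, so the right-hand
    side is the proportion of good ones among them. The bound passes to means
    over the children ([run_dominated]), because [hits] is additive over them.
    With f the indicator of a slope M it turns a lower bound on a probability
    into a lower bound on [hits]. *)
Definition dominated (M : nat) f := forall w P,
  all (mem letters) w -> good (letter_prod w) P -> (P < 36 * letter_prod w)%N ->
  f w (P %% 36)%N <= (letter_prod w)%:R / M%:R * (hits M (letter_prod w) P)%:R.

Lemma run_dominated M k r f : (k < 5)%N -> dominated M f -> dominated M (run k r f).
Proof.
move=> k5 df; elim: r => [//|r IH] w P wL gP lP /=.
set j := (P %% 36)%N; set a := policy k j.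
have m0 : (0 < letter_prod w)%N by lia.
have j33 : (j < 33)%N by case: gP.
have /and3P[aL _ _] := policy_valid k5 j33; rewrite -/a in aL.
have /andP[a2 _] := letters_ge2 aL.
have a0 : (0 : R) < a%:R by rewrite ltr0n; lia.
rewrite ler_pdivrMr // (@hits_split M _ _ a); last by lia.
rewrite natr_sum mulr_sumr mulr_suml; apply: ler_sum => i _.
have [gi <-] := good_child k5 gP (ltn_ord i) m0; rewrite -/j -/a in gi *.
apply: le_trans (IH (a :: w) _ _ gi _) _.
- by rewrite /= wL andbT.
- by rewrite /=; have := ltn_ord i; nia.
- by rewrite /= natrM le_eqVlt; apply/orP; left; apply/eqP; ring.
Qed.

Lemma mode_lt w : all (mem letters) w -> (mode w < 5)%N /\ imbalance (mode w) w <= 0.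
Proof.
move=> wL; have S0 := imbalance_sum wL.
have h : has (fun i => imbalance i w <= 0) (iota 0 5) by rewrite /=; lia.
have k5 : (mode w < 5)%N by rewrite /mode -[5%N](size_iota 0 5) -has_find.
split=> //; have := nth_find 0%N h.
by rewrite -/(mode w) nth_iota.
Qed.

(** The size of u matters in the applications: the change of an imbalance over a
    block is bounded in terms of the length of the block. *)
Lemma run_le k r f g w j : (k < 5)%N -> (j < 33)%N ->
  (forall u j', size u = r -> all (mem letters) u -> (j' < 33)%N ->
     f (u ++ w) j' <= g (u ++ w) j') ->
  run k r f w j <= run k r g w j.
Proof.
move=> k5; elim: r w j => [|r IH] w j j33 H /=; first exact: (H [::]).
have /and3P[aL _ _] := policy_valid k5 j33.
rewrite ler_pM2r ?invr_gt0 ?ltr0n; last by have := letters_ge2 aL; lia.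
apply: ler_sum => i _; apply: IH; first exact: next_lt.
move=> u j' su uL j'33; rewrite -cat_rcons; apply: H => //.
  by rewrite size_rcons su.
by rewrite all_rcons; apply/andP; split.
Qed.

Lemma run_affine k r f (x y : R) w j : (k < 5)%N -> (j < 33)%N ->
  run k r (fun w j => x * f w j + y) w j = x * run k r f w j + y.
Proof.
move=> k5; elim: r w j => [//|r IH] w j j33 /=.
have /and3P[aL _ _] := policy_valid k5 j33.
rewrite (eq_bigr (fun i : 'I_(policy k j) =>
  x * run k r f (policy k j :: w) (next (policy k j) j i) + y)); last first.
  by move=> i _; rewrite IH //; apply: next_lt.
rewrite big_split /= -mulr_sumr sumr_const card_ord -mulr_natr.
have a0 : (policy k j)%:R != 0 :> R.
  by rewrite pnatr_eq0; have := letters_ge2 aL; lia.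
by field.
Qed.

Lemma run_sum (I : finType) k r (F : I -> seq nat -> nat -> R) w j :
  run k r (fun w j => \sum_(z : I) F z w j) w j = \sum_(z : I) run k r (F z) w j.
Proof.
elim: r w j => [//|r IH] w j /=.
rewrite -mulr_suml exchange_big /=; congr (_ / _).
by apply: eq_bigr => i _; rewrite IH.
Qed.

Lemma blocks_dominated M s f : dominated M f -> dominated M (blocks s f).
Proof.
move=> df; elim: s => [//|s IH] w P wL gP lP.
by have [k5 _] := mode_lt wL; by have := run_dominated q k5 IH; apply.
Qed.

Lemma blocks_le s f g w j : all (mem letters) w -> (j < 33)%N ->
  (forall u j', size u = (s * q)%N -> all (mem letters) u -> (j' < 33)%N ->
     f (u ++ w) j' <= g (u ++ w) j') ->
  blocks s f w j <= blocks s g w j.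
Proof.
elim: s w j => [|s IH] w j wL j33 H /=; first exact: (H [::]).
have [k5 _] := mode_lt wL.
apply: run_le => // u j' su uL j'33; apply: IH => //; first by rewrite all_cat uL.
move=> v j'' sv vL j''33; rewrite catA; apply: H => //.
  by rewrite size_cat sv su mulSn addnC.
by rewrite all_cat vL.
Qed.

Lemma blocks_affine s f (x y : R) w j : all (mem letters) w -> (j < 33)%N ->
  blocks s (fun w j => x * f w j + y) w j = x * blocks s f w j + y.
Proof.
elim: s w j => [//|s IH] w j wL j33 /=; have [k5 _] := mode_lt wL.
rewrite -run_affine //; apply/eqP; rewrite eq_le; apply/andP.
by split; apply: run_le => // u j' _ uL j'33; rewrite IH // all_cat uL.
Qed.

Lemma blocks_sum (I : finType) s (F : I -> seq nat -> nat -> R) w j :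
  all (mem letters) w -> (j < 33)%N ->
  blocks s (fun w j => \sum_(z : I) F z w j) w j = \sum_(z : I) blocks s (F z) w j.
Proof.
elim: s w j => [//|s IH] w j wL j33 /=; have [k5 _] := mode_lt wL.
rewrite -run_sum; apply/eqP; rewrite eq_le; apply/andP.
by split; apply: run_le => // u j' _ uL j'33; rewrite IH // all_cat uL.
Qed.
End Operators.

(** * The drift of the imbalances *)

(** One step of a dynamic program that bounds the expected growth of the
    imbalance i under policy k from each of the 33 offsets, in tenths. The
    division rounds down and the added 1 makes up for it, so that the rows are
    upper bounds. The a children have consecutive offsets, whence the slice.
    Binary integers make the rows cheap to compute. *)
Definition drift_row (k i : nat) (row : seq BinNums.Z) : seq BinNums.Z :=
  [seq let a := policy k j in
       let total := foldr BinInt.Z.add BinNums.Z0 (take a (drop (next a j 0) row)) in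
       BinInt.Z.add (BinInt.Z.mul (Z_of_int 10%Z) (Z_of_int (weight i a)))
         (BinInt.Z.add (BinInt.Z.div total (BinInt.Z.of_nat a)) (Z_of_int 1%Z))
  | j <- iota 0 33].

Definition drift_rows (k i r : nat) : seq BinNums.Z :=
  iter r (drift_row k i) (nseq 33 BinNums.Z0).

Lemma size_drift_rows k i r : size (drift_rows k i r) = 33%N.
Proof. by case: r => [|r]; rewrite ?size_nseq //= size_map size_iota. Qed.

Lemma sum_slice (s : seq BinNums.Z) lo a : (lo + a <= size s)%N ->
  foldr BinInt.Z.add BinNums.Z0 (take a (drop lo s)) = \sum_(i < a) nth 0 s (lo + i).
Proof.
move=> h; rewrite -[LHS]/(foldr +%R 0 (take a (drop lo s))) foldrE (big_nth 0).
rewrite size_takel; last by rewrite size_drop; move: h; set n := size s; lia.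
by rewrite big_mkord; apply: eq_bigr => i _; rewrite nth_take // nth_drop.
Qed.

Section Drift.
Context {R : realType}.

Lemma run_drift k i r w j : (k < 5)%N -> (j < 33)%N ->
  run k r (fun w _ => (imbalance i w)%:~R : R) w j
    <= (imbalance i w)%:~R + (int_of_Z (nth 0 (drift_rows k i r) j))%:~R / 10.
Proof.
move=> k5; elim: r w j => [|r IH] w j j33.
  have -> : nth 0 (drift_rows k i 0) j = 0 by rewrite /drift_rows /iter nth_nseq j33.
  by rewrite /= mul0r addr0.
rewrite [run _ _ _ _ _]/=.
rewrite -[drift_rows k i r.+1]/(drift_row k i (drift_rows k i r)) /drift_row.
have /and3P[aL lo hi] := policy_valid k5 j33.
have /andP[a2 a14] := letters_ge2 aL.
rewrite (nth_map 0%N) ?size_iota // nth_iota // add0n.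
set a := policy k j in aL lo hi a2 a14 *.
have a0 : (0 : R) < a%:R by rewrite ltr0n; lia.
rewrite sum_slice ?size_drift_rows; last by rewrite /next; lia.
set T := \sum_(c < a) _.
set D := int_of_Z (BinInt.Z.add _ _).
have ED : D = 10%Z * weight i a + int_of_Z (BinInt.Z.div T (BinInt.Z.of_nat a)) + 1%Z.
  by rewrite /D; lia.
rewrite ler_pdivrMr //.
apply: (@le_trans _ _ (\sum_(c < a) ((imbalance i (a :: w))%:~R +
   (int_of_Z (nth 0 (drift_rows k i r) (next a j 0 + c)))%:~R / 10))).
  apply: ler_sum => c _.
  have -> : (next a j 0 + c = next a j c)%N by rewrite /next; lia.
  by apply: IH; apply: next_lt.
rewrite big_split /= sumr_const card_ord -mulr_suml -rmorph_sum /= -rmorph_sum /= -/T.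
have : int_of_Z T <= a%:Z * (int_of_Z (BinInt.Z.div T (BinInt.Z.of_nat a)) + 1).
  have := BinInt.Z.mul_succ_div_gt T (BinInt.Z.of_nat a); lia.
rewrite ED; move: (int_of_Z (BinInt.Z.div _ _)) (int_of_Z T) => d t.
rewrite -(ler_int R) !(rmorphM, rmorphD) /= => H.
rewrite -mulr_natr; lra.
Qed.

(** -10 tenths: the mean of each imbalance but the k-th falls by 1 at least. *)
Definition drifts_down (r : nat) : bool :=
  all (fun k => all (fun i => (i == k) ||
    all (fun z => BinInt.Z.leb z (Z_of_int (-10)%Z)) (drift_rows k i r))
  (iota 0 5)) (iota 0 5).

Lemma drifts_down_run r k i w j : drifts_down r ->
  (k < 5)%N -> (i < 5)%N -> i != k -> (j < 33)%N ->
  run k r (fun w _ => (imbalance i w)%:~R : R) w j <= (imbalance i w)%:~R - 1.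
Proof.
move=> dr k5 i5 ik j33; apply: le_trans (run_drift _ _ _ k5 j33) _.
have /allP/(_ k)/(_ _)/allP/(_ i) := dr; rewrite !mem_iota => /(_ k5 i5).
rewrite (negPf ik) orFb => /allP/(_ (nth 0 (drift_rows k i r) j)).
rewrite mem_nth ?size_drift_rows // => /(_ isT) h.
have : int_of_Z (nth 0 (drift_rows k i r) j) <= (-10)%Z by lia.
rewrite lerD2l -(ler_int R) => H; lra.
Qed.
End Drift.

(** The drift per letter outweighs the rounding, and over 110 letters it also
    makes up for the transient due to the starting offset. *)
Lemma drifts_down_110 : drifts_down 110.
Proof. by vm_compute. Qed.

(** * Keeping the imbalances bounded in mean *)

Lemma imbalance_cat i u w : imbalance i (u ++ w) = imbalance i u + imbalance i w.
Proof. by elim: u => [|a u IH] /=; rewrite ?add0r // IH addrA. Qed.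

Lemma imbalance_bound i u : (i < 5)%N -> all (mem letters) u ->
  (`|imbalance i u| <= 100 * size u)%N.
Proof.
move=> i5; elim: u => [//|a u IH] /andP[aL /IH].
rewrite -[imbalance i (a :: u)]/(weight i a + imbalance i u) -[size (a :: u)]/(size u).+1.
suff : (`|weight i a| <= 100)%N by move: (weight i a) (imbalance i u) => x y; lia.
have /allP/(_ i)/(_ _)/allP/(_ a aL) : all (fun i => all (fun a =>
  (`|weight i a| <= 100)%N) letters) (iota 0 5) by vm_compute.
by rewrite mem_iota; apply.
Qed.

Definition balanced (L : nat) (w : seq nat) : bool := [forall i : 'I_5, imbalance i w <= L%:Z].

Lemma balancedP L w i : balanced L w -> (i < 5)%N -> imbalance i w <= L%:Z.
Proof. by move=> /forallP h i5; have := h (Ordinal i5). Qed.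

Section Steering.
Context {R : realType}.

Lemma expR_le_quad (x : R) : x <= 1 / 2 -> expR x <= 1 + x + 2 * x ^+ 2.
Proof.
move=> x2; have e1 := expR_ge1Dx (- x); have e0 := expR_gt0 x.
have eN : expR x * expR (- x) = 1 by rewrite -expRD subrr expR0.
have h : expR x * (1 - x) <= 1 by rewrite -[leRHS]eN ler_pM2l.
have x1 : 0 < 1 - x by lra.
rewrite -(ler_pM2r x1); apply: le_trans h _; nra.
Qed.

Definition potential (eta : R) (w : seq nat) : R :=
  \sum_(i < 5) expR (eta * (imbalance i w)%:~R).

(** With B a bound on the change y of an imbalance x over one block, eta is
    chosen such that eta B^2 = 1/4. If i is not the current mode, the mean of y
    is at most -1 and exp (eta y) <= 1 + eta y + 2 (eta B)^2 gives a factor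
    1 - eta / 2 in mean. If i is the mode, then x <= 0 and the term is at most
    2 after the block whatever happens. *)
Lemma run_potential (q : nat) (eta : R) w j : drifts_down q ->
  eta = (4 * (100 * q%:R + 1) ^+ 2)^-1 ->
  all (mem letters) w -> (j < 33)%N ->
  run (mode w) q (fun w _ => potential eta w) w j <= (1 - eta / 2) * potential eta w + 2.
Proof.
move=> dr Eeta wL j33; have [k5 lk] := mode_lt wL; set k := mode w in k5 lk *.
set B : R := 100 * q%:R + 1 in Eeta.
have B1 : 1 <= B by rewrite /B; have := ler0n R q; lra.
have eta0 : 0 < eta by rewrite Eeta invr_gt0; nra.
have etaB : eta * B ^+ 2 = 1 / 4.
  by rewrite Eeta; field; rewrite gt_eqF //; lra.
have small i u : (i < 5)%N -> size u = q -> all (mem letters) u ->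
    `|(imbalance i u)%:~R : R| <= B.
  move=> i5 su uL; have := imbalance_bound i5 uL; rewrite su => h.
  rewrite -intr_norm (@le_trans _ _ (100 * q)%:R) //.
    rewrite -[(100 * q)%:R]/((100 * q)%N%:Z%:~R) ler_int.
    by move: (imbalance i u) h => x h; lia.
  by rewrite natrM /B; lra.
have eta1 : eta <= 1 / 4 by have : 1 <= B ^+ 2 by [nra]; nra.
have -> : (1 - eta / 2) * potential eta w + 2 =
    \sum_(i < 5) ((1 - eta / 2) * expR (eta * (imbalance i w)%:~R) +
                  (if i == Ordinal k5 then 2 else 0)).
  by rewrite big_split /= -mulr_sumr -big_mkcond big_pred1_eq.
rewrite run_sum; apply: ler_sum => i _.
set x := (imbalance i w)%:~R : R.
have e0 := expR_gt0 (eta * x).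
have [ik|ik] := eqVneq i (Ordinal k5).
  have x0 : x <= 0 by rewrite /x ik -[0]/(0%:~R) ler_int.
  apply: (@le_trans _ _ (run k q (fun w _ => 0 * potential eta w + 2) w j)).
    apply: run_le => // u j' su uL j'33; rewrite mul0r add0r imbalance_cat rmorphD /=.
    have := small i u (ltn_ord i) su uL; rewrite ler_norml => /andP[s1 s2].
    move: s1 s2; rewrite -/x; set y := (imbalance i u)%:~R => s1 s2.
    have h : eta * (y + x) <= 1 / 2 by nra.
    have h4 : eta * (y + x) <= eta * B by rewrite ler_pM2l; lra.
    have h5 : expR (eta * (y + x)) <= expR (1 / 2) by rewrite ler_expR.
    by have := expR_le_quad (lexx (1 / 2 : R)); lra.
  by rewrite run_affine // mul0r add0r; nra.
apply: (@le_trans _ _ (run k q (fun w _ => (expR (eta * x) * eta) * (imbalance i w)%:~R +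
     expR (eta * x) * (1 + 2 * (eta * B) ^+ 2 - eta * x)) w j)).
  apply: run_le => // u j' su uL j'33; rewrite imbalance_cat rmorphD /=.
  have := small i u (ltn_ord i) su uL; rewrite ler_norml => /andP[s1 s2].
  move: s1 s2; rewrite -/x; set y := (imbalance i u)%:~R => s1 s2.
  rewrite mulrDr expRD mulrC -mulrA -mulrDr ler_pM2l //.
  have h : eta * y <= 1 / 2 by nra.
  apply: le_trans (expR_le_quad h) _.
  have : (eta * y) ^+ 2 <= (eta * B) ^+ 2.
    by rewrite !exprMn ler_pM2l ?exprn_gt0 //; nra.
  lra.
rewrite run_affine //.
have ik' : (i : nat) != k by apply: contra ik => /eqP ik; apply/eqP/val_inj.
set D := run _ _ _ _ _.
have d : D <= x - 1 := drifts_down_run w dr k5 (ltn_ord i) ik' j33.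
have h2 : expR (eta * x) * eta * D <= expR (eta * x) * eta * (x - 1).
  by apply: ler_wpM2l => //; rewrite mulr_ge0 // ltW.
have h3 : (eta * B) ^+ 2 = eta / 4 by rewrite exprMn expr2 -mulrA etaB; lra.
rewrite addr0 h3; nra.
Qed.

(** 4 / eta is the fixed point of the contraction v |-> (1 - eta / 2) v + 2. *)
Lemma blocks_potential (q : nat) (eta : R) s w j : drifts_down q ->
  eta = (4 * (100 * q%:R + 1) ^+ 2)^-1 ->
  all (mem letters) w -> (j < 33)%N ->
  blocks q s (fun w _ => potential eta w) w j
    <= (1 - eta / 2) ^+ s * potential eta w + (1 - (1 - eta / 2) ^+ s) * (4 / eta).
Proof.
move=> dr Eeta; have q0 := ler0n R q.
have eta0 : 0 < eta by rewrite Eeta invr_gt0; nra.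
have eta1 : eta <= 1 / 4.
  by rewrite Eeta invf_ple ?posrE; nra.
elim: s w j => [|s IH] w j wL j33; first by rewrite expr0 /=; lra.
have [k5 _] := mode_lt wL; rewrite [blocks _ _ _ _ _]/=.
set rho := (1 - eta / 2) in IH *.
have rs : 0 <= rho ^+ s by apply: exprn_ge0; rewrite /rho; lra.
apply: (@le_trans _ _ (run (mode w) q (fun w _ => rho ^+ s * potential eta w +
   (1 - rho ^+ s) * (4 / eta)) w j)).
  by apply: run_le => // u j' _ uL j'33; apply: IH => //; rewrite all_cat uL.
rewrite run_affine //.
have h := ler_wpM2l rs (run_potential dr Eeta wL j33).
apply: le_trans (lerD h (lexx _)) _.
rewrite exprS -/rho le_eqVlt; apply/orP; left; apply/eqP; rewrite /rho; field.
by rewrite gt_eqF.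
Qed.

(** Markov: if some imbalance exceeds L then the potential exceeds
    eta L > 2 K, where K bounds its mean; this has probability at most 1/2. *)
Lemma steered : exists q L : nat, (0 < q)%N /\ forall s,
  1 / 2 <= blocks q s (fun w _ => (balanced L w)%:R : R) [::] 0%N.
Proof.
have [q q0 dr] : exists2 q, (0 < q)%N & drifts_down q.
  by exists 110%N => //; exact: drifts_down_110.
exists q.
pose eta : R := (4 * (100 * q%:R + 1) ^+ 2)^-1.
have qR := ler0n R q.
have eta0 : 0 < eta by rewrite invr_gt0; nra.
have eta1 : eta <= 1 / 4 by rewrite invf_ple ?posrE; nra.
pose K : R := 5 + 4 / eta.
have K0 : 0 < K by rewrite addr_gt0 // divr_gt0.
have [L HL] : exists L : nat, 2 * K / eta < L%:R.
  by exists (Num.bound (2 * K / eta)); apply: archi_boundP; rewrite divr_ge0; lra.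
exists L; split=> // s.
have bK : blocks q s (fun w _ => potential eta w) [::] 0%N <= K.
  have h := @blocks_potential q eta s [::] 0%N dr erefl isT isT; apply: le_trans h _.
  have -> : potential eta [::] = 5.
    by rewrite /potential; under eq_bigr do rewrite mulr0 expR0; rewrite sumr_const card_ord.
  have : 0 <= (1 - eta / 2) ^+ s by apply: exprn_ge0; lra.
  have : (1 - eta / 2) ^+ s <= 1 by apply: exprn_ile1; lra.
  set p := _ ^+ s; have : 0 < 4 / eta by rewrite divr_gt0.
  rewrite /K; nra.
apply: (@le_trans _ _ (blocks q s (fun w _ => (- (2 * K)^-1) * potential eta w + 1) [::] 0%N)).
  rewrite blocks_affine //.
  have : (2 * K)^-1 * blocks q s (fun w _ => potential eta w) [::] 0%N <= (2 * K)^-1 * K.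
    by rewrite ler_pM2l // invr_gt0; lra.
  have -> : (2 * K)^-1 * K = 1 / 2 by field; rewrite gt_eqF.
  lra.
apply: blocks_le => // u j' su uL j'33; rewrite cats0.
have p0 (i : 'I_5) : expR (eta * (imbalance i u)%:~R) <= potential eta u.
  rewrite /potential (bigD1 i) //= lerDl; apply: sumr_ge0 => ? _; exact: expR_ge0.
have K2 : 0 < (2 * K)^-1 by rewrite invr_gt0; lra.
case bu: (balanced L u); last first.
  move/negbT: bu; rewrite negb_forall => /existsP[i]; rewrite -ltNge => Li.
  have := p0 i; have := expR_ge1Dx (eta * (imbalance i u)%:~R).
  have : 2 * K <= eta * (imbalance i u)%:~R.
    rewrite [leRHS]mulrC -ler_pdivrMr //; apply: ltW; apply: (lt_trans HL).
    by rewrite -[L%:R]/(L%:Z%:~R) ltr_int.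
  move=> h1 h2 h3; have : (2 * K)^-1 * (2 * K) <= (2 * K)^-1 * potential eta u.
    by rewrite ler_pM2l //; lra.
  rewrite mulVf; last by rewrite gt_eqF //; lra.
  by rewrite mulNr; set z := _ * potential _ _ => h4; apply: le_trans (ler0n _ _); lra.
have pot0 : 0 <= potential eta u := le_trans (expR_ge0 _) (p0 ord0).
have : 0 <= (2 * K)^-1 * potential eta u := mulr_ge0 (ltW K2) pot0.
rewrite mulNr; set z := _ * potential _ _ => z0.
by rewrite mulr1n; lra.
Qed.
End Steering.

(** * Balanced words of a given length *)

Lemma size_counts w : all (mem letters) w -> size w =
  (count_mem 2 w + count_mem 3 w + count_mem 5 w + count_mem 9 w + count_mem 14 w)%N.
Proof.
elim: w => [//|a w IH] /andP[aL /IH E]; rewrite /= E.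
by move: aL; rewrite !inE => /or4P[/eqP->|/eqP->|/eqP->|/orP[]/eqP->] /=; lia.
Qed.

Lemma imbalance_counts i w : all (mem letters) w -> imbalance i w =
  weight i 2 * (count_mem 2%N w)%:Z + weight i 3 * (count_mem 3%N w)%:Z
  + weight i 5 * (count_mem 5%N w)%:Z + weight i 9 * (count_mem 9%N w)%:Z
  + weight i 14 * (count_mem 14%N w)%:Z.
Proof.
elim: w => [|a w IH] wL; first by rewrite !mulr0.
case/andP: wL => aL /IH {}IH; rewrite -[imbalance i (a :: w)]/(weight i a + imbalance i w) IH.
rewrite [count_mem 2%N _]/= [count_mem 3%N _]/= [count_mem 5%N _]/=.
rewrite [count_mem 9%N _]/= [count_mem 14%N _]/= !PoszD !mulrDr.
by move: aL; rewrite !inE => /or4P[/eqP->|/eqP->|/eqP->|/orP[]/eqP->] /=;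
  rewrite !mulr0 !mulr1 !add0r; ring.
Qed.

Lemma letter_prod_counts w : all (mem letters) w -> letter_prod w =
  (2 ^ count_mem 2 w * 3 ^ count_mem 3 w * 5 ^ count_mem 5 w
   * 9 ^ count_mem 9 w * 14 ^ count_mem 14 w)%N.
Proof.
elim: w => [//|a w IH] /andP[aL /IH E]; rewrite -[letter_prod (a :: w)]/(a * letter_prod w)%N {}E.
rewrite [count_mem 2%N (_ :: _)]/= [count_mem 3%N (_ :: _)]/= [count_mem 5%N (_ :: _)]/=.
rewrite [count_mem 9%N (_ :: _)]/= [count_mem 14%N (_ :: _)]/= !expnD.
by move: aL; rewrite !inE => /or4P[/eqP->|/eqP->|/eqP->|/orP[]/eqP->] /=;
  rewrite !expn0 !expn1; ring.
Qed.

(** The length and four of the imbalances are linearly independent forms in the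
    five letter counts. *)
Lemma letter_prod_determined w w' : all (mem letters) w -> all (mem letters) w' ->
  size w = size w' -> (forall i, (i < 4)%N -> imbalance i w = imbalance i w') ->
  letter_prod w = letter_prod w'.
Proof.
move=> wL w'L; rewrite (size_counts wL) (size_counts w'L) => e.
move=> E; have := (E 0 isT, E 1 isT, E 2 isT, E 3 isT); move: e.
rewrite !(imbalance_counts _ wL) !(imbalance_counts _ w'L) (letter_prod_counts wL) (letter_prod_counts w'L).
rewrite {E} /weight /=.
move: (count_mem 2%N w) (count_mem 3%N w) (count_mem 5%N w) (count_mem 9%N w) (count_mem 14%N w).
move: (count_mem 2%N w') (count_mem 3%N w') (count_mem 5%N w') (count_mem 9%N w') (count_mem 14%N w').
move=> a' b' c' d' e' a b c d e E [[[E0 E1] E2] E3].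
have -> : a = a' by lia.
have -> : b = b' by lia.
have -> : c = c' by lia.
have -> : d = d' by lia.
by have -> : e = e' by lia.
Qed.

(** Each letter count is a linear form in the length and the imbalances, with
    coefficients small enough that a balanced word longer by q has at most
    q + L more copies of each letter; 3780 = 2 * 3 * 5 * 9 * 14. *)
Lemma letter_prod_ratio L q w w' : all (mem letters) w -> all (mem letters) w' ->
  balanced L w -> balanced L w' -> size w' = (q + size w)%N ->
  (letter_prod w' <= 3780 ^ (q + L) * letter_prod w)%N.
Proof.
move=> wL w'L bw bw'; rewrite (size_counts wL) (size_counts w'L).
have /= := (balancedP bw (i := 0) isT, balancedP bw (i := 1) isT, balancedP bw (i := 2) isT,
   balancedP bw (i := 3) isT, balancedP bw (i := 4) isT).
have /= := (balancedP bw' (i := 0) isT, balancedP bw' (i := 1) isT, balancedP bw' (i := 2) isT,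
   balancedP bw' (i := 3) isT, balancedP bw' (i := 4) isT).
rewrite !(imbalance_counts _ wL) !(imbalance_counts _ w'L) (letter_prod_counts wL) (letter_prod_counts w'L).
rewrite {bw bw'} /weight /=.
move: (count_mem 2%N w) (count_mem 3%N w) (count_mem 5%N w) (count_mem 9%N w) (count_mem 14%N w).
move: (count_mem 2%N w') (count_mem 3%N w') (count_mem 5%N w') (count_mem 9%N w') (count_mem 14%N w').
move=> a' b' c' d' e' a b c d e [[[[E0' E1'] E2'] E3'] E4'] [[[[E0 E1] E2] E3] E4] E.
have -> : 3780%N = (2 * 3 * 5 * 9 * 14)%N by [].
rewrite !expnMn.
have ha : (2 ^ a' <= 2 ^ (q + L) * 2 ^ a)%N by rewrite -expnD leq_exp2l //; lia.
have hb : (3 ^ b' <= 3 ^ (q + L) * 3 ^ b)%N by rewrite -expnD leq_exp2l //; lia.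
have hc : (5 ^ c' <= 5 ^ (q + L) * 5 ^ c)%N by rewrite -expnD leq_exp2l //; lia.
have hd : (9 ^ d' <= 9 ^ (q + L) * 9 ^ d)%N by rewrite -expnD leq_exp2l //; lia.
have he : (14 ^ e' <= 14 ^ (q + L) * 14 ^ e)%N by rewrite -expnD leq_exp2l //; lia.
apply: leq_trans (leq_mul (leq_mul (leq_mul (leq_mul ha hb) hc) hd) he) _.
by rewrite leq_eqVlt; apply/orP; left; apply/eqP; ring.
Qed.

(** The imbalances sum to zero and the other four are at most L. *)
Lemma balanced_range L w i : all (mem letters) w -> balanced L w -> (i < 5)%N ->
  0 <= imbalance i w + (4 * L)%N%:Z <= (5 * L)%N%:Z.
Proof.
move=> wL bw i5; have E := imbalance_sum wL.
have := (balancedP bw (i := 0) isT, balancedP bw (i := 1) isT, balancedP bw (i := 2) isT,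
   balancedP bw (i := 3) isT, balancedP bw (i := 4) isT) => -[[[[E0 E1] E2] E3] E4].
move: i5; do 5!(case: i => [|i]; first by lia).
by [].
Qed.

Section Pigeonhole.
Context {R : realType}.

(** The cells z of the pigeonhole record the values of the first four
    imbalances; c is half the inverse of the number of cells. The mass of the
    chosen z is at most the mass of the words of slope M, which
    [blocks_dominated] compares with [hits M 1 0], hence with the number of
    elements in the window of M. *)
Lemma many_elements : exists q L : nat, exists2 c : R, 0 < c &
  (0 < q)%N /\ forall s, exists w,
  [/\ all (mem letters) w, size w = (s * q)%N, balanced L w &
    c * (letter_prod w)%:R <= (window_count (letter_prod w))%:R].
Proof.
have [q [L [q0 H]]] := @steered R; exists q, L.
pose T := {ffun 'I_4 -> 'I_(5 * L).+1}.
pose c : R := (2 * #|T|%:R)^-1.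
have T0 : (0 : R) < #|T|%:R.
  by rewrite ltr0n; apply/card_gt0P; exists [ffun=> ord0].
have c0 : 0 < c by rewrite invr_gt0 mulr_gt0.
exists (c / 36); first by rewrite divr_gt0.
split=> // s; have nilL : all (mem letters) [::] by [].
pose cell (z : T) (w : seq nat) : bool :=
  balanced L w && [forall i : 'I_4, imbalance i w + (4 * L)%N%:Z == (z i : nat)%:Z].
have [z hz] : exists z, c <= blocks q s (fun w _ => (cell z w)%:R : R) [::] 0%N.
  apply: contrapT => /forallNP hz.
  have : \sum_(z : T) blocks q s (fun w _ => (cell z w)%:R : R) [::] 0%N < \sum_(z : T) c.
    apply: ltr_sum; last by move=> z _; rewrite ltNge; apply/negP/hz.
    by apply/hasP; exists [ffun=> ord0] => //; rewrite mem_index_enum.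
  rewrite sumr_const -mulr_natr.
  have -> : c * #|T|%:R = 1 / 2 by rewrite /c; field; rewrite gt_eqF.
  rewrite -blocks_sum // ltNge => /negP; apply; apply: le_trans (H s) _.
  apply: blocks_le => // u j' su uL j'33; rewrite cats0.
  case bu: (balanced L u); last first.
    by apply: sumr_ge0 => ? _; rewrite ler0n.
  pose z0 : T := [ffun i : 'I_4 => inord (absz (imbalance i u + (4 * L)%N%:Z))].
  rewrite (bigD1 z0) //= (_ : cell z0 u) ?lerDl; first by apply: sumr_ge0 => ? _; rewrite ler0n.
  rewrite /cell bu; apply/forallP => i; rewrite ffunE.
  have i5 : (i < 5)%N by apply: leq_trans (ltn_ord i) _.
  have := balanced_range uL bu i5 => h.
  by rewrite inordK; lia.
have [w [wL sw zw]] : exists w, [/\ all (mem letters) w, size w = (s * q)%N & cell z w].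
  apply: contrapT => hw; move: hz; apply/negP; rewrite -ltNge.
  apply: le_lt_trans c0; apply: (@le_trans _ _
     (blocks q s (fun w _ => 0 * 0 + 0) [::] 0%N)); last by rewrite blocks_affine // mul0r addr0.
  apply: blocks_le => // u j' su uL j'33; rewrite cats0 mul0r addr0.
  by case zu: (cell z u) => //; case: hw; exists u.
have /andP[bw /forallP lw] := zw.
exists w; split=> //; set M := letter_prod w.
have M0 : (0 < M)%N := leq_ltn_trans (leq0n _) (size_lt_letter_prod wL).
have MR : (0 : R) < M%:R by rewrite ltr0n.
have dM : dominated M (fun u _ => (letter_prod u == M)%:R : R).
  move=> u P uL gP lP; case: eqP gP lP => [->|_] gP lP.
    by rewrite divff ?gt_eqF // mul1r ler_nat (hits_self gP lP).
  by rewrite mulr_ge0 ?ler0n // divr_ge0 // ler0n.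
(* The element 17 = 16 + 1 of A starts the expansions. *)
have good0 : good 1 0 by split=> //; exact: setA23_17.
have := blocks_dominated q s dM nilL good0 isT.
rewrite mod0n [letter_prod [::]]/= => hM.
have hzM : c <= 1%:R / M%:R * (hits M 1 0)%:R.
  apply: le_trans hz (le_trans _ hM); apply: blocks_le => // u j' su uL j'33.
  rewrite cats0; case zu: (cell z u); last by rewrite ler0n.
  have /andP[_ /forallP lu] := zu.
  rewrite (letter_prod_determined uL wL) ?eqxx ?su ?sw // => i i4.
  have /eqP := lu (Ordinal i4); have /eqP := lw (Ordinal i4) => /= <-.
  by move/addIr.
have := hits_le M0; rewrite -(ler_nat R) natrM => h36.
move: hzM; rewrite mul1r mulrC ler_pdivlMr // => hc.
rewrite -(ler_pM2l (x := 36)) // mulrA; lra.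
Qed.
End Pigeonhole.

(** * Comparison with the counting function *)

Lemma window_count_le_count_upto (R : realType) M (x : R) : (17 * M)%:R <= x ->
  (window_count M <= count_upto setA23 x)%N.
Proof.
move=> Mx; rewrite /count_upto; set B := setA23 `&` _.
have finB : finite_set B.
  apply: (@sub_finite_set _ _ `I_(Num.bound x)); last exact: finite_II.
  move=> n [_ /andP[n1 nx]] /=.
  have := archi_boundP (le_trans (le_trans ler01 n1) nx).
  by move/(le_lt_trans nx); rewrite ltr_nat.
pose s := [seq (16 * M + q + 1)%N | q <- iota 0 M & `[< setA23 (16 * M + q + 1)%N >]].
have -> : window_count M = size s.
  have -> : s = [seq (16 * M + q + 1)%N | q <- index_iota 0 M
                & `[< setA23 (16 * M + q + 1)%N >]] by rewrite /index_iota subn0.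
  rewrite size_map size_filter -sum1_count big_mkcond big_mkord.
  by apply: eq_bigr => q _; case: asboolP.
apply: uniq_leq_size.
  rewrite map_inj_uniq ?filter_uniq ?iota_uniq // => a b; lia.
move=> n /mapP[q]; rewrite mem_filter mem_iota => /andP[/asboolP Aq qM] ->.
rewrite in_fset_set // inE; split=> //=; apply/andP; split.
  by rewrite ler1n; lia.
by apply: le_trans Mx; rewrite ler_nat; lia.
Qed.

Unset Implicit Arguments.

Theorem theorem1 (R : realType) :
  exists c : R, 0 < c /\
    \forall x \near +oo, c * x <= (count_upto setA23 x)%:R.
Proof.
have [q [L [c c0 [q0 /choice[W HW]]]]] := @many_elements R.
pose M s := letter_prod (W s).
pose K := (3780 ^ (q + L))%N.
have K0 : (0 < K)%N by rewrite expn_gt0.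
have M0 : M 0%N = 1%N.
  by rewrite /M; have [_ + _ _] := HW 0%N; rewrite mul0n => /size0nil ->.
have Mbig s : (s < M s)%N.
  have [wL sw _ _] := HW s; have := size_lt_letter_prod wL; rewrite sw.
  by apply: leq_trans; rewrite ltnS leq_pmulr.
have MS s : (M s.+1 <= K * M s)%N.
  have [wL sw bw _] := HW s; have [w'L sw' bw' _] := HW s.+1.
  by apply: letter_prod_ratio => //; rewrite sw sw' mulSn.
have KR : (0 : R) < K%:R by rewrite ltr0n.
exists (c / (17 * K%:R)); split; first by rewrite divr_gt0 ?mulr_gt0.
(* Take the least s with x < 17 M_s; then 17 M_(s-1) <= x < 17 K M_(s-1). *)
near=> x.
have x17 : 17 <= x by near: x; apply: nbhs_pinfty_ge; rewrite num_real.
have x0 : 0 <= x by lra.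
have ex : exists s, (fun s => x < (17 * M s)%:R) s.
  exists (Num.bound x); apply: (lt_le_trans (archi_boundP x0)).
  by rewrite ler_nat; have := Mbig (Num.bound x); lia.
case: (ex_minnP ex) => -[|s] xs smin; first by move: xs; rewrite M0 muln1 ltNge x17.
have sx : (17 * M s)%:R <= x.
  by rewrite leNgt; apply/negP => /smin; rewrite ltnn.
have [_ _ _ cM] := HW s; rewrite -/(M s) in cM.
have h : (window_count (M s))%:R <= (count_upto setA23 x)%:R :> R.
  by rewrite ler_nat window_count_le_count_upto.
apply: le_trans (le_trans cM h).
rewrite mulrAC ler_pdivrMr ?mulr_gt0 // -mulrA ler_pM2l //.
apply/ltW/(lt_le_trans xs).
by rewrite -[17 in leRHS]/(17%N%:R) -!natrM ler_nat; have := MS s; nia.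
Unshelve. all: by end_near. Qed.
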